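(* Let $J\subseteq[n]$ be such that $M^0_J$ is invertible, let $N=[n]\setminus J$, and let $D\in\mathbb{R}^{n\times k}$ and $r\in\mathbb{R}^n$ be given by $$D_{J,i}=\tilde M^{J,i}q_J\ (i\in[k]),\quad r_J=-(M^0_J)^{-1}q_J,\quad D_{N,\cdot}=0,\quad r_N=0.$$ Suppose that $J=\{j\in[n]:r_j>0\}$ and that $D_{[h],\cdot}=0$. Then $z(\zeta)=D\zeta+r$ is an AAR solution of the uncertain LCP $$0\le z(\zeta)\perp M(\zeta)z(\zeta)+q\ge 0\quad\text{for all }\zeta\in\mathcal{U}$$ if and only if the following three conditions are fulfilled: $$q_J\in\bigcap_{i,j\in[k]}\ker\left(M^i_J\tilde M^{J,j}+M^j_J\tilde M^{J,i}\right),$$ $$\left(\sum_{i\in[k]}\zeta_i\tilde M^{J,i}-(M^0_J)^{-1}\right)q_J\ge 0\quad\text{for all }\zeta\in\mathcal{U},$$ $$M_{N,J}(\zeta)\left(\sum_{i\in[k]}\zeta_i\tilde M^{J,i}-(M^0_J)^{-1}\right)q_J+q_N\ge 0\quad\text{for all }\zeta\in\mathcal{U}.$$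
   Context: Notation: $[n]=\{1,\dots,n\}$. For a matrix $A$ and index sets $I,J$, $A_{I,J}$ is the submatrix with rows in $I$ and columns in $J$, $A_I=A_{I,I}$ (so $M^i_J=(M^i)_{J,J}$, and $M_{N,J}(\zeta)=(M(\zeta))_{N,J}$), and $A_{I,\cdot}$ consists of the rows in $I$; $D_{J,i}$ is the subvector, indexed by $J$, of the $i$-th column of $D$; $b_I$ is the subvector of $b$ indexed by $I$. Vector inequalities are componentwise, and $0\le a\perp b\ge 0$ means $a\ge0$, $b\ge0$, $a^\top b=0$. Data: matrices $M^0,M^1,\dots,M^k\in\mathbb{R}^{n\times n}$, $q\in\mathbb{R}^n$, $h\in\{0,\dots,n\}$, the uncertainty set $\mathcal{U}=[-1,1]^k$, and $M(\zeta)=M^0+\sum_{i=1}^k\zeta_iM^i$ for $\zeta\in\mathcal{U}$. For $I\subseteq[n]$ with $M^0_I$ invertible and $i\in[k]$, define $\tilde M^{I,i}=(M^0_I)^{-1}M^i_I(M^0_I)^{-1}$. An affinely adjustable robust (AAR) solution of this uncertain LCP is an affine function $z(\zeta)=D\zeta+r$ with $D\in\mathbb{R}^{n\times k}$, $r\in\mathbb{R}^n$ and $D_{[h],\cdot}=0$ (the first $h$ rows of $D$ are zero), such that $0\le z(\zeta)\perp M(\zeta)z(\zeta)+q\ge0$ for all $\zeta\in\mathcal{U}$. *)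

(* Defs.v *)
From HB Require Import structures.
From mathcomp Require Import all_boot all_order all_algebra.
From mathcomp Require Import reals.

Set Implicit Arguments.
Unset Strict Implicit.
Unset Printing Implicit Defensive.

Import Order.TTheory GRing.Theory Num.Theory.
Local Open Scope ring_scope.

(* The index sets [n] and [k] are the 0-based types 'I_n and 'I_k; vectors are
   columns.  A_{I,J} has its rows and columns listed in increasing order of the
   indices in I and J ([enum_val] enumerates a set of ordinals increasingly). *)
Section Submatrices.
Variable R : realType.

Definition sub_mx m n (I : {set 'I_m}) (J : {set 'I_n}) (A : 'M[R]_(m, n)) :
    'M[R]_(#|I|, #|J|) :=
  mxsub (@enum_val _ (mem I)) (@enum_val _ (mem J)) A.

(* A_{I,.}, and b_I when b is a column *)
Definition sub_rows m n (I : {set 'I_m}) (A : 'M[R]_(m, n)) : 'M[R]_(#|I|, n) :=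
  rowsub (@enum_val _ (mem I)) A.

Definition nonneg_cV n (v : 'cV[R]_n) : Prop := forall i, 0 <= v i ord0.

(* 0 <= a _|_ b >= 0 *)
Definition complementary n (a b : 'cV[R]_n) : Prop :=
  [/\ nonneg_cV a, nonneg_cV b & a^T *m b = 0].

End Submatrices.

Section UncertainLCP.
Variables (R : realType) (n k : nat).
Implicit Types (M : 'I_k -> 'M[R]_n) (q r : 'cV[R]_n).
Implicit Types (D : 'M[R]_(n, k)) (zeta : 'cV[R]_k).

Definition in_box zeta : Prop := forall i, -1 <= zeta i ord0 <= 1.

(* M0 is M^0, and M i, for i : 'I_k, is M^{i+1}. *)
Definition unc_mx (M0 : 'M[R]_n) M zeta : 'M[R]_n :=
  M0 + \sum_(i < k) zeta i ord0 *: M i.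

(* M~^{I,i}; meaningful when M^0_I is invertible *)
Definition tilde_mx (M0 : 'M[R]_n) M (I : {set 'I_n}) (i : 'I_k) : 'M[R]_#|I| :=
  invmx (sub_mx I I M0) *m sub_mx I I (M i) *m invmx (sub_mx I I M0).

Definition affine_rule D r zeta : 'cV[R]_n := D *m zeta + r.

Definition first_idx (h : nat) : {set 'I_n} := [set i : 'I_n | (i < h)%N].

(* The affine function zeta |-> D zeta + r, given by its coefficients, is an
   affinely adjustable robust solution whose first h components are
   nonadjustable. *)
Definition AAR_solution (h : nat) (M0 : 'M[R]_n) M q D r : Prop :=
  sub_rows (first_idx h) D = 0 /\
  forall zeta, in_box zeta ->
    complementary (affine_rule D r zeta)
                  (unc_mx M0 M zeta *m affine_rule D r zeta + q).

End UncertainLCP.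

(* Main.v *)
(* On [J], the residual [M(zeta) z(zeta) + q] is the homogeneous quadratic map
   [sum_ij zeta_i zeta_j M^i_J M~^{J,j} q_J].  Since [z_J] is nonnegative on the
   box and positive at [0], it is positive on the half-size box, where
   complementarity makes the residual vanish; by polarization, vanishing there
   is the kernel condition. *)
Require Import Defs.
From HB Require Import structures.
From mathcomp Require Import all_boot all_order all_algebra.
From mathcomp Require Import reals lra.

Set Implicit Arguments.
Unset Strict Implicit.
Unset Printing Implicit Defensive.

Import Order.TTheory GRing.Theory Num.Theory.
Local Open Scope ring_scope.

Section Submatrix.
Variable R : realType.

Lemma sub_rows_enum_rank m n (I : {set 'I_m}) (A : 'M[R]_(m, n)) i j
  (iI : i \in I) : sub_rows I A (enum_rank_in iI i) j = A i j.
Proof. by rewrite mxE enum_rankK_in. Qed.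

Lemma sub_rows_eq0 m n (I : {set 'I_m}) (A : 'M[R]_(m, n)) :
  sub_rows I A = 0 <-> forall i j, i \in I -> A i j = 0.
Proof.
split=> [A0 i j iI | A0].
  by rewrite -(sub_rows_enum_rank A j iI) A0 mxE.
by apply/matrixP=> i j; rewrite !mxE A0 ?enum_valP.
Qed.

Lemma nonneg_sub_rows m (I : {set 'I_m}) (v : 'cV[R]_m) :
  nonneg_cV (sub_rows I v) <-> forall i, i \in I -> 0 <= v i ord0.
Proof.
split=> [v0 i iI | v0 i]; first by rewrite -(sub_rows_enum_rank v _ iI).
by rewrite mxE v0 ?enum_valP.
Qed.

(** The columns of [A] outside [J] only meet zero entries of [v]. This reduces every block of rows
    of [M(zeta) z(zeta)] to the columns in [J]. *)
Lemma sub_rows_mul_supp m n (I : {set 'I_m}) (J : {set 'I_n})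
    (A : 'M[R]_(m, n)) (v : 'cV[R]_n) :
  sub_rows (~: J) v = 0 ->
  sub_rows I (A *m v) = sub_mx I J A *m sub_rows J v.
Proof.
move=> /sub_rows_eq0 v0; apply/matrixP=> i j; rewrite !mxE.
rewrite (bigID (mem J)) /= addrC big1 ?add0r => [|l lJ]; last first.
  by rewrite v0 ?mulr0 ?inE.
by rewrite big_enum_val; apply: eq_bigr => l _; rewrite !mxE.
Qed.

Lemma sub_unc_mx n k (I J : {set 'I_n}) (M0 : 'M[R]_n) (M : 'I_k -> 'M[R]_n)
    (zeta : 'cV[R]_k) :
  sub_mx I J (unc_mx M0 M zeta) =
  sub_mx I J M0 + \sum_(i < k) zeta i ord0 *: sub_mx I J (M i).
Proof.
rewrite /unc_mx /sub_mx; apply/matrixP=> i j; rewrite !(mxE, summxE).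
by congr (_ + _); apply: eq_bigr => l _; rewrite !mxE.
Qed.

(** A sum of nonnegative products vanishes only if each product does. *)
Lemma complementaryP n (a b : 'cV[R]_n) :
  complementary a b <->
  [/\ nonneg_cV a, nonneg_cV b & forall i, a i ord0 * b i ord0 = 0].
Proof.
split=> -[a0 b0 ab]; split=> //.
  move=> i; move/matrixP/(_ ord0 ord0): ab; rewrite !mxE => ab.
  have := psumr_eq0P _ ab (i := i) isT; rewrite mxE; apply=> j _.
  by rewrite mxE mulr_ge0.
apply/matrixP=> i j; rewrite !ord1 !mxE big1 // => l _.
by rewrite mxE ab.
Qed.

End Submatrix.

Section QuadraticMap.
Variables (R : realType) (k m : nat) (c : 'I_k -> 'I_k -> 'cV[R]_m).
Implicit Types a b zeta : 'cV[R]_k.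

(** The coefficients [c i j] need not be symmetric; on the diagonal [a = b] only the sums
    [c i j + c j i] matter. *)
Definition polar_map a b : 'cV[R]_m :=
  \sum_i \sum_j (a i ord0 * b j ord0) *: c i j.

Lemma polar_mapDl a b zeta :
  polar_map (a + b) zeta = polar_map a zeta + polar_map b zeta.
Proof.
rewrite -big_split; apply: eq_bigr => i _ /=; rewrite -big_split.
by apply: eq_bigr => j _ /=; rewrite mxE mulrDl scalerDl.
Qed.

Lemma polar_mapDr a b zeta :
  polar_map zeta (a + b) = polar_map zeta a + polar_map zeta b.
Proof.
rewrite -big_split; apply: eq_bigr => i _ /=; rewrite -big_split.
by apply: eq_bigr => j _ /=; rewrite mxE mulrDr scalerDl.
Qed.

Lemma polar_map_delta x y i j :
  polar_map (x *: delta_mx i ord0) (y *: delta_mx j ord0) = (x * y) *: c i j.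
Proof.
rewrite /polar_map (bigD1 i) //= (bigD1 j) //= !mxE !eqxx !mulr1.
rewrite !big1 ?addr0 // => [i' /negPf ni | j' /negPf nj].
  by apply: big1 => j' _; rewrite !mxE ni mulr0 mul0r scale0r.
by rewrite !mxE nj !mulr0 scale0r.
Qed.

(** Exchanging the two summation indices pairs [c i j] with [c j i], so twice the value is zero. *)
Lemma quadratic_map_eq0 zeta :
  (forall i j, c i j + c j i = 0) -> polar_map zeta zeta = 0.
Proof.
move=> c0.
have /eqP : polar_map zeta zeta + polar_map zeta zeta = 0.
  rewrite {2}/polar_map exchange_big -big_split big1 // => i _ /=.
  rewrite -big_split big1 // => j _ /=.
  by rewrite (mulrC (zeta j _)) -scalerDr c0 scaler0.
by rewrite -mulr2n -scaler_nat scaler_eq0 pnatr_eq0 => /eqP.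
Qed.

(* Polarization at [e_i] and [e_j], scaled to stay in the box. *)
Lemma quadratic_map_box_eq0 x i j : x != 0 ->
  (forall zeta, in_box zeta -> polar_map (x *: zeta) (x *: zeta) = 0) ->
  c i j + c j i = 0.
Proof.
(* The factor 1/2 keeps [e i + e j] in the box even when [i = j]. *)
move=> x0 Q0; pose e l : 'cV[R]_k := 2^-1 *: delta_mx l ord0.
have e_ge0 l s : 0 <= e l s ord0.
  by rewrite !mxE mulr_ge0 ?invr_ge0 ?ler0n.
have e_le l s : e l s ord0 <= 2^-1.
  by rewrite !mxE ler_piMr ?invr_ge0 ?ler0n // lern1 leq_b1.
have box zeta : (forall s, 0 <= zeta s ord0 <= 1) -> in_box zeta.
  move=> z01 s; have /andP[z0 ->] := z01 s.
  by rewrite andbT (le_trans _ z0) // lerN10.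
have e_box l : in_box (e l).
  apply: box => s; rewrite e_ge0 (le_trans (e_le _ _)) //.
  by rewrite invf_le1 ?ltr0n // ler1n.
have ee_box : in_box (e i + e j).
  apply: box => s; rewrite mxE addr_ge0 //=.
  by rewrite [leRHS](splitr 1) mul1r lerD.
have /eqP := Q0 _ ee_box.
(* The two pure terms vanish by [Q0]; the mixed terms add up to a nonzero multiple of
   [c i j + c j i]. *)
rewrite scalerDr polar_mapDl !polar_mapDr !Q0 // add0r addr0.
rewrite /e !scalerA !polar_map_delta -scalerDr scaler_eq0 !mulf_eq0.
by rewrite (negPf x0) invr_eq0 pnatr_eq0 => /eqP.
Qed.

End QuadraticMap.

Section Residual.
Variables (R : realType) (n k : nat) (M0 : 'M[R]_n) (M : 'I_k -> 'M[R]_n).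
Variables (q : 'cV[R]_n) (J : {set 'I_n}).

(** When [M^0_J] is invertible, this is the first-order expansion at [zeta = 0] of
    [- M_J(zeta)^-1 q_J], the solution [x] of [M_J(zeta) x + q_J = 0]. *)
Definition policy (zeta : 'cV[R]_k) : 'cV[R]_#|J| :=
  (\sum_(i < k) zeta i ord0 *: tilde_mx M0 M J i - invmx (sub_mx J J M0))
  *m sub_rows J q.

(* The terms of order at most one in [zeta] cancel because
   [M0_J *m tilde_mx i = M^i_J *m invmx M0_J]. *)
Lemma policy_residual (MJ_inv : sub_mx J J M0 \in unitmx) (zeta : 'cV[R]_k) :
  sub_mx J J (unc_mx M0 M zeta) *m policy zeta + sub_rows J q =
  polar_map (fun i j => sub_mx J J (M i) *m tilde_mx M0 M J j *m sub_rows J q)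
    zeta zeta.
Proof.
rewrite sub_unc_mx /policy mulmxA; set A := sub_mx J J M0.
set T := \sum_i _ *: tilde_mx _ _ _ i; set B := \sum_i _.
have AT : A *m T = B *m invmx A.
  rewrite mulmx_sumr mulmx_suml; apply: eq_bigr => i _.
  by rewrite -scalemxAr -scalemxAl /tilde_mx !mulmxA mulmxV // mul1mx.
have -> : (A + B) *m (T - invmx A) = B *m T - 1%:M.
  by rewrite mulmxDl !mulmxBr AT mulmxV // addrC addrA subrK.
rewrite mulmxBl mul1mx subrK /B /T mulmx_suml mulmx_suml.
apply: eq_bigr => i _; rewrite mulmx_sumr mulmx_suml; apply: eq_bigr => j _.
by rewrite -scalemxAl -scalemxAr scalerA -scalemxAl.
Qed.

Lemma sub_rows_affine_rule (D : 'M[R]_(n, k)) (r : 'cV[R]_n) (zeta : 'cV[R]_k) :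
  (forall i, sub_rows J (col i D) = tilde_mx M0 M J i *m sub_rows J q) ->
  sub_rows J r = - (invmx (sub_mx J J M0) *m sub_rows J q) ->
  sub_rows J (affine_rule D r zeta) = policy zeta.
Proof.
move=> DJ rJ; rewrite /policy mulmxBl -rJ mulmx_suml.
apply/matrixP=> s t; rewrite ord1 !(mxE, summxE); congr (_ + _).
by apply: eq_bigr => i _; rewrite -scalemxAl -DJ !mxE mulrC.
Qed.

End Residual.

Theorem theorem6 (R : realType) (n k h : nat) (hn : (h <= n)%N)
  (M0 : 'M[R]_n) (M : 'I_k -> 'M[R]_n) (q : 'cV[R]_n)
  (J : {set 'I_n}) (MJ_inv : sub_mx J J M0 \in unitmx)
  (D : 'M[R]_(n, k)) (r : 'cV[R]_n)
  (DJ : forall i : 'I_k,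
     sub_rows J (col i D) = tilde_mx M0 M J i *m sub_rows J q)
  (rJ : sub_rows J r = - (invmx (sub_mx J J M0) *m sub_rows J q))
  (DN : sub_rows (~: J) D = 0)
  (rN : sub_rows (~: J) r = 0)
  (J_pos : J = [set j : 'I_n | 0 < r j ord0])
  (Dh : sub_rows (first_idx n h) D = 0) :
  AAR_solution h M0 M q D r <->
  [/\ forall i j : 'I_k,
        (sub_mx J J (M i) *m tilde_mx M0 M J j
         + sub_mx J J (M j) *m tilde_mx M0 M J i) *m sub_rows J q = 0,
      forall zeta : 'cV[R]_k, in_box zeta ->
        nonneg_cV ((\sum_(i < k) zeta i ord0 *: tilde_mx M0 M J i
                    - invmx (sub_mx J J M0)) *m sub_rows J q)
    & forall zeta : 'cV[R]_k, in_box zeta ->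
        nonneg_cV (sub_mx (~: J) J (unc_mx M0 M zeta)
                   *m ((\sum_(i < k) zeta i ord0 *: tilde_mx M0 M J i
                        - invmx (sub_mx J J M0)) *m sub_rows J q)
                   + sub_rows (~: J) q)].
Proof.
have zJ zeta := sub_rows_affine_rule zeta DJ rJ.
have zN zeta : sub_rows (~: J) (affine_rule D r zeta) = 0.
  apply/sub_rows_eq0=> i j iN; rewrite mxE (proj1 (sub_rows_eq0 _ _) rN) //.
  rewrite addr0 mxE big1 // => l _.
  by rewrite (proj1 (sub_rows_eq0 _ _) DN) ?mul0r.
pose w zeta := unc_mx M0 M zeta *m affine_rule D r zeta + q.
(* The row set [I] is left free: [I = J] leads to the kernel condition, and [I = ~: J] to the third
   condition. *)
have wE I zeta : sub_rows I (w zeta) =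
    sub_mx I J (unc_mx M0 M zeta) *m policy M0 M q J zeta + sub_rows I q.
  rewrite -zJ -(sub_rows_mul_supp _ _ (zN zeta)).
  by apply/matrixP=> i j; rewrite !mxE.
have wJ zeta := etrans (wE J zeta) (policy_residual M q MJ_inv zeta).
split=> [[_ sol] | [ker zJ0 wN0]].
  have {}sol zeta zbox := proj1 (complementaryP _ _) (sol zeta zbox).
  split=> [i j | zeta zbox | zeta zbox].
  - rewrite mulmxDl.
    pose c i' j' := sub_mx J J (M i') *m tilde_mx M0 M J j' *m sub_rows J q.
    (* On the boundary of the box [z_J] may have zero entries, and complementarity then says nothing
       about the residual. Any scaling factor strictly between 0 and 1 avoids this. *)
    apply: (@quadratic_map_box_eq0 _ _ _ c 2^-1 i j).
      by rewrite invr_eq0 pnatr_eq0.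
    move=> zeta zbox; rewrite -[LHS]wJ.
    apply/sub_rows_eq0=> s t sJ; rewrite ord1.
    have hbox : in_box (2^-1 *: zeta).
      move=> l; have /andP[lo hi] := zbox l; rewrite mxE; lra.
    have [_ _ /(_ s)/eqP] := sol _ hbox.
    rewrite mulf_eq0 => /orP[|/eqP //].
    (* An affine function that is positive at [0] and nonnegative at [zeta] is
       positive at [zeta / 2]. *)
    have [/(_ s) + _ _] := sol _ zbox.
    have := sJ; rewrite J_pos inE /affine_rule -scalemxAr !mxE => r_gt0 z_ge0.
    by rewrite gt_eqF //; lra.
  - have [z0 _ _] := sol _ zbox; rewrite -/(policy _ _ _ _ _) -zJ.
    by apply/nonneg_sub_rows=> i _.
  have [_ w0 _] := sol _ zbox; rewrite -/(policy _ _ _ _ _) -wE.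
  by apply/nonneg_sub_rows=> i _.
(* Conversely, the residual vanishes on [J] by the kernel condition and [z] vanishes off [J], so
   every product is zero. The other two conditions give the signs of [z] on [J] and of the residual
   off [J]. *)
split=> // zeta zbox; apply/complementaryP.
have wJ0 : sub_rows J (w zeta) = 0.
  rewrite wJ; apply: quadratic_map_eq0 => i j.
  by rewrite -mulmxDl; apply: ker.
have {}zN i : i \notin J -> affine_rule D r zeta i ord0 = 0.
  by move=> iN; apply: (proj1 (sub_rows_eq0 _ _) (zN zeta)); rewrite inE.
have {}wJ0 i : i \in J -> w zeta i ord0 = 0.
  exact: (proj1 (sub_rows_eq0 _ _) wJ0).
split=> i; have [iJ | iN] := boolP (i \in J).
- move: zJ0 => /(_ zeta zbox); rewrite -/(policy _ _ _ _ _) -zJ.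
  by move=> /nonneg_sub_rows; apply.
- by rewrite zN.
- by rewrite -/(w zeta) wJ0.
- move: wN0 => /(_ zeta zbox); rewrite -/(policy _ _ _ _ _) -wE.
  by move=> /nonneg_sub_rows; apply; rewrite inE.
- by rewrite -/(w zeta) wJ0 ?mulr0.
by rewrite zN ?mul0r.
Qed.
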